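(* Let $q$ be a positive even integer. Then there exists a real number $C=C(q)>1$ such that for every $\varepsilon\in(0,1)$ we have $$N_q^{\mathrm{int}}(\varepsilon,d)\ \ge\ C^d\,(1+o(1))\qquad\text{as } d\to\infty,$$ i.e. there is a sequence $(r_d)_{d\ge1}$ (possibly depending on $\varepsilon$) with $r_d\to0$ and $N_q^{\mathrm{int}}(\varepsilon,d)\ge C^d(1+r_d)$ for all $d$. In particular, the integration problem in $F_{d,q}$ suffers from the curse of dimensionality.
   Context: For $q\in[1,\infty)$, $W_q^{\boldsymbol 1}=W_q^{(1,\dots,1)}([0,1]^d)$ denotes the $d$-fold tensor product of the space of absolutely continuous functions on $[0,1]$ with first derivative in $L_q([0,1])$, i.e. functions on $[0,1]^d$ once differentiable in each variable whose mixed derivative $\frac{\partial^d f}{\partial\boldsymbol{x}}=\frac{\partial^d f}{\partial x_1\cdots\partial x_d}$ lies in $L_q$. Let $\|f\|_{d,q}=\left(\int_{[0,1]^d}\left|\frac{\partial^d f}{\partial\boldsymbol{x}}(\boldsymbol{x})\right|^q d\boldsymbol{x}\right)^{1/q}$ and $F_{d,q}=\{f\in W_q^{\boldsymbol 1}: f(\boldsymbol{x})=0 \text{ whenever } x_j=0 \text{ for some } j,\ \|f\|_{d,q}<\infty\}$. Let $I_d(f)=\int_{[0,1]^d}f(\boldsymbol{x})\,d\boldsymbol{x}$. An algorithm using $N$ function evaluations has the form $A_{d,N}(f)=\varphi(f(\boldsymbol{x}_1),\dots,f(\boldsymbol{x}_N))$ with arbitrary $\varphi:\mathbb{R}^N\to\mathbb{R}$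 satisfying $\varphi(0,\dots,0)=0$ and nodes $\boldsymbol{x}_1,\dots,\boldsymbol{x}_N\in[0,1)^d$. Its worst-case error is $e(F_{d,q},A_{d,N})=\sup_{f\in F_{d,q},\|f\|_{d,q}\le1}|I_d(f)-A_{d,N}(f)|$. The $N$-th minimal worst-case error $e_q(N,d)$ is the infimum of $e(F_{d,q},A_{d,N})$ over all such algorithms, and the initial error is $e_q(0,d)=\sup_{f\in F_{d,q},\|f\|_{d,q}\le1}|I_d(f)|$. The information complexity is $N_q^{\mathrm{int}}(\varepsilon,d)=\min\{N\in\mathbb{N}: e_q(N,d)\le\varepsilon\, e_q(0,d)\}$. *)

(* Defs.v *)
From HB Require Import structures.
From mathcomp Require Import all_boot all_order all_algebra.
From mathcomp Require Import all_classical all_reals all_analysis.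
Unset Printing Implicit Defensive.
Import Order.TTheory GRing.Theory Num.Theory.
Import numFieldNormedType.Exports.
Local Open Scope classical_set_scope.
Local Open Scope ring_scope.

Section Defs.
Context {R : realType}.

(* Lebesgue integral over the unit cube [0,1]^d of a function on d-tuples,
   written as the d-fold iterated one-dimensional Lebesgue integral
   (the library has no d-fold product measure; by Fubini/Tonelli this is
   the integral w.r.t. d-dimensional Lebesgue measure for jointly measurable
   integrable or nonnegative integrands). *)
Fixpoint cube_int (d : nat) : (d.-tuple R -> \bar R) -> \bar R :=
  match d return (d.-tuple R -> \bar R) -> \bar R with
  | 0 => fun f => f [tuple]
  | d'.+1 => fun f =>
      (\int[lebesgue_measure]_(t in `[0%R, 1%R]) cube_int d' (fun y => f (cons_tuple t y)))%E
  end.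

Definition Lq_norm (q d : nat) (g : d.-tuple R -> R) : \bar R :=
  ((cube_int d (fun t => (`|g t| ^+ q)%:E)) `^ (q%:R^-1))%E.

(* An element of the unit ball of F_{d,q}: f(x) = \int_{[0,x]} g(t) dt
   with g = d^d f / dx its mixed derivative, g in L_q, ||g||_q <= 1. *)
Definition box_below (d : nat) (x t : d.-tuple R) : bool :=
  [forall i : 'I_d, tnth t i <= tnth x i].

Definition F_of (d : nat) (g : d.-tuple R -> R) (x : d.-tuple R) : R :=
  fine (cube_int d (fun t => (g t * (box_below d x t)%:R)%:E)).

Definition unit_ball (q d : nat) : set (d.-tuple R -> R) :=
  [set g | measurable_fun setT g /\ (Lq_norm q d g <= 1)%E].

Definition I_d (d : nat) (f : d.-tuple R -> R) : R :=
  fine (cube_int d (fun x => (f x)%:E)).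

Definition wc_error (q d N : nat) (X : 'I_N -> d.-tuple R)
    (phi : ('I_N -> R) -> R) : \bar R :=
  ereal_sup [set (`| I_d d (F_of d g) - phi (fun i => F_of d g (X i)) |)%:E
            | g in unit_ball q d].

Definition admissible_nodes (d N : nat) (X : 'I_N -> d.-tuple R) : Prop :=
  forall (k : 'I_N) (j : 'I_d), 0 <= tnth (X k) j /\ tnth (X k) j < 1.

Definition min_error (q N d : nat) : \bar R :=
  ereal_inf [set wc_error q d N X phi | X in admissible_nodes d N &
            phi in [set phi : ('I_N -> R) -> R | phi (fun _ => 0) = 0]].

Definition init_error (q d : nat) : \bar R :=
  ereal_sup [set (`| I_d d (F_of d g) |)%:E | g in unit_ball q d].

(* information complexity N_q^int(eps,d) (= +oo if no such N exists) *)
Definition N_int (q : nat) (eps : R) (d : nat) : \bar R :=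
  ereal_inf [set (N%:R)%:E | N in
            [set N : nat | (min_error q N d <= eps%:E * init_error q d)%E]].

End Defs.

(* Main.v *)
(* Put w(t) = prod_j (1 - t_j) and let G be the tensor power of
   (1 - s)^(1/(q-1)), so that G^(q-1) = w.  By Tonelli the integral of the
   function with mixed derivative g is the pairing of g and w; Hoelder's
   inequality bounds the initial error, and G is the equality case.

   In one variable G is split into three pieces u + v_0 + v_1 such that the
   primitive of v_1 vanishes left of 1/2 and that of v_0 right of 1/2, while
   the q-th power of the L_q norm of |u| + |v_e| and the pairing of u + v_e
   with 1 - s are, for e = 0 and e = 1, at most kappa < 1 times those of
   u + v_0 + v_1.  In the expansion of G as a tensor power, the only products
   whose primitive does not vanish at a node x are those built in coordinate j
   from u and v_e, with e = 1 iff x_j >= 1/2.  The sum of the products that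
   vanish at all N nodes differs from G, by a union bound over the nodes, by a
   relative amount O(N^(q+1) kappa^d) in the q-th power of the norm.  So as
   long as N < C^d, with C^(q+2) = 1 / kappa, this fooling function is
   asymptotically as good as G itself. *)
Require Import Defs.
From HB Require Import structures.
From mathcomp Require Import all_boot all_order all_algebra.
From mathcomp Require Import all_classical all_reals all_analysis.
From mathcomp Require Import measurable_realfun ring lra.
Import Order.TTheory GRing.Theory Num.Theory.
Import numFieldNormedType.Exports.
Local Open Scope classical_set_scope.
Local Open Scope ring_scope.

(** * Iterated integrals over the cube *)

Section CubeIntegral.
Context {R : realType}.
Local Notation mu := (@lebesgue_measure R).
Local Notation I01 := (`[0%R, 1%R]%classic : set R).
Local Open Scope ereal_scope.

(** Tonelli's measurability statement concerns nonnegative functions on the whole line, so [D]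
    enters as an indicator factor and the positive and negative parts are treated separately. *)
Lemma measurable_slice_integral d (T : measurableType d) (D : set R)
    (f : T * R -> \bar R) :
  measurable D -> measurable_fun setT f ->
  measurable_fun setT (fun x => \int[mu]_(s in D) f (x, s)).
Proof.
move=> mD mf; pose g (z : T * R) := f z * (\1_D z.2)%:E.
have mg : measurable_fun setT g.
  apply: emeasurable_funM => //; apply/measurable_EFinP.
  by apply: measurableT_comp => //; exact: measurable_indic.
have -> : (fun x => \int[mu]_(s in D) f (x, s)) = (fun x =>
    \int[mu]_s g^\+ (x, s) - \int[mu]_s g^\- (x, s)).
  apply/funext => x; rewrite integral_mkcond integralE.
  have E : (fun s => f (x, s)) \_ D = fun s => g (x, s).
    by apply/funext => s; rewrite epatch_indic.
  by rewrite E; congr (_ - _); apply: eq_integral => s _;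
    rewrite ?funeposE ?funenegE.
apply: emeasurable_funB.
  apply: (measurable_fun_fubini_tonelli_F (m2 := mu) g^\+) => //.
  exact: measurable_funepos.
apply: (measurable_fun_fubini_tonelli_F (m2 := mu) g^\-) => //.
exact: measurable_funeneg.
Qed.

Lemma slice_integral_swap (D : set R) (f : R * R -> \bar R) :
  measurable D -> measurable_fun setT f -> (forall z, 0 <= f z) ->
  \int[mu]_(x in D) \int[mu]_(y in D) f (x, y) =
  \int[mu]_(y in D) \int[mu]_(x in D) f (x, y).
Proof.
move=> mD mf f0; pose g (z : R * R) := f z * (\1_D z.1 * \1_D z.2)%:E.
have mg : measurable_fun setT g.
  apply: emeasurable_funM => //; apply/measurable_EFinP.
  by apply: measurable_funM; apply: measurableT_comp => //;
    exact: measurable_indic.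
have g0 z : 0 <= g z by rewrite mule_ge0// lee_fin mulr_ge0.
transitivity (\int[mu]_x \int[mu]_y g (x, y)).
  rewrite integral_mkcond; apply: eq_integral => x _.
  rewrite /patch; case: ifPn => xD.
    rewrite integral_mkcond; apply: eq_integral => y _.
    by rewrite epatch_indic /g/= [\1_D x]indicE xD mul1r.
  by rewrite integral0_eq// => y _; rewrite /g/= [\1_D x]indicE (negbTE xD)
    mul0r mule0.
rewrite fubini_tonelli//.
rewrite [RHS]integral_mkcond; apply: eq_integral => y _.
rewrite /patch; case: ifPn => yD.
  rewrite [RHS]integral_mkcond; apply: eq_integral => x _.
  by rewrite epatch_indic /g/= [\1_D y]indicE yD mulr1.
by rewrite integral0_eq// => x _; rewrite /g/= [\1_D y]indicE (negbTE yD)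
  mulr0 mule0.
Qed.

Lemma measurable_cons_tuple n :
  measurable_fun setT (fun z : R * n.-tuple R => cons_tuple z.1 z.2).
Proof. exact: measurable_cons. Qed.

Lemma measurable_slice d (T : measurableType d) d' (T' : measurableType d')
    (f : T * T' -> \bar R) x :
  measurable_fun setT f -> measurable_fun setT (fun y => f (x, y)).
Proof. by move=> mf; apply: measurableT_comp => //. Qed.

(** The parameter space is arbitrary so that the induction can move the first coordinate of the cube
    into it, passing from [T] to [T * R]. *)
Lemma measurable_cube_int n d (T : measurableType d)
    (f : T * n.-tuple R -> \bar R) :
  measurable_fun setT f ->
  measurable_fun setT (fun x => cube_int n (fun t => f (x, t))).
Proof.
elim: n d T f => [|n IH] d T f mf /=.
  by apply: (measurableT_comp mf); exact: measurable_pair2.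
apply: (measurable_slice_integral _ _ _
  (fun z => cube_int n (fun y => f (z.1, cons_tuple z.2 y)))) => //.
apply: (IH _ _ (fun z : (T * R) * n.-tuple R =>
  f (z.1.1, cons_tuple z.1.2 z.2))).
apply: (measurableT_comp mf); apply/measurable_fun_pair => /=.
  exact: measurableT_comp.
apply: measurable_cons => //; exact: measurableT_comp.
Qed.

Lemma measurable_cube_int_cons n (f : n.+1.-tuple R -> \bar R) :
  measurable_fun setT f ->
  measurable_fun setT (fun s => cube_int n (fun y => f (cons_tuple s y))).
Proof.
move=> mf; apply: (measurable_cube_int _ _ _ (fun z => f (cons_tuple z.1 z.2))).
exact: (measurableT_comp mf (@measurable_cons_tuple n)).
Qed.

Lemma measurable_fun_cons n (f : n.+1.-tuple R -> \bar R) s :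
  measurable_fun setT f -> measurable_fun setT (fun y => f (cons_tuple s y)).
Proof.
move=> mf; apply: (measurable_slice _ _ _ _ (fun z => f (cons_tuple z.1 z.2))).
exact: (measurableT_comp mf (@measurable_cons_tuple n)).
Qed.

Lemma cube_int_ge0 n (f : n.-tuple R -> \bar R) :
  (forall t, 0 <= f t) -> 0 <= cube_int n f.
Proof.
by elim: n f => [|n IH] f f0 //=; apply: integral_ge0 => s _; exact: IH.
Qed.

Lemma le_cube_int n (f g : n.-tuple R -> \bar R) :
  measurable_fun setT f -> measurable_fun setT g ->
  (forall t, 0 <= f t) -> (forall t, f t <= g t) ->
  cube_int n f <= cube_int n g.
Proof.
elim: n f g => [|n IH] f g mf mg f0 fg //=.
apply: ge0_le_integral => //.
- by move=> s _; exact: cube_int_ge0.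
- by apply: measurable_funTS; exact: measurable_cube_int_cons.
- by apply: measurable_funTS; exact: measurable_cube_int_cons.
- by move=> s _; apply: IH => //; exact: measurable_fun_cons.
Qed.

Lemma le_abse_cube_int n (f : n.-tuple R -> \bar R) :
  measurable_fun setT f -> `|cube_int n f| <= cube_int n (fun t => `|f t|).
Proof.
elim: n f => [|n IH] f mf //=.
have mcf := measurable_cube_int_cons _ _ mf.
have maf : measurable_fun setT (fun t => `|f t|) by exact: measurableT_comp.
apply: le_trans (le_abse_integral _ _ _) _ => //; first exact: measurable_funTS.
apply: ge0_le_integral => //.
- by apply: measurable_funTS; exact: measurableT_comp.
- by apply: measurable_funTS; exact: (measurable_cube_int_cons _ _ maf).
- by move=> s _; apply: IH => //; exact: measurable_fun_cons.
Qed.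

Lemma cube_intD n (f g : n.-tuple R -> \bar R) :
  measurable_fun setT f -> measurable_fun setT g ->
  (forall t, 0 <= f t) -> (forall t, 0 <= g t) ->
  cube_int n (fun t => f t + g t) = cube_int n f + cube_int n g.
Proof.
elim: n f g => [|n IH] f g mf mg f0 g0 //=.
rewrite -ge0_integralD//.
- by apply: eq_integral => s _; apply: IH => //; exact: measurable_fun_cons.
- by move=> s _; exact: cube_int_ge0.
- by apply: measurable_funTS; exact: measurable_cube_int_cons.
- by move=> s _; exact: cube_int_ge0.
- by apply: measurable_funTS; exact: measurable_cube_int_cons.
Qed.

Lemma cube_intZl n (k : R) (f : n.-tuple R -> \bar R) :
  (0 <= k)%R -> measurable_fun setT f -> (forall t, 0 <= f t) ->
  cube_int n (fun t => k%:E * f t) = k%:E * cube_int n f.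
Proof.
move=> k0; elim: n f => [|n IH] f mf f0 //=.
rewrite -ge0_integralZl_EFin//.
- by apply: eq_integral => s _; apply: IH => //; exact: measurable_fun_cons.
- by move=> s _; exact: cube_int_ge0.
- by apply: measurable_funTS; exact: measurable_cube_int_cons.
Qed.

Lemma cube_int_integral_swap n (f : R * n.-tuple R -> \bar R) :
  measurable_fun setT f -> (forall z, 0 <= f z) ->
  cube_int n (fun x => \int[mu]_(s in I01) f (s, x)) =
  \int[mu]_(s in I01) cube_int n (fun x => f (s, x)).
Proof.
elim: n f => [|n IH] f mf f0 //=.
have mf3 : measurable_fun setT (fun z : R * (R * n.-tuple R) =>
    f (z.1, cons_tuple z.2.1 z.2.2)).
  apply: (measurableT_comp mf); apply/measurable_fun_pair => //=.
  apply: (measurableT_comp (@measurable_cons_tuple n)) => //.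
transitivity (\int[mu]_(r in I01) \int[mu]_(s in I01)
    cube_int n (fun y => f (s, cons_tuple r y))).
  apply: eq_integral => r _.
  apply: (IH (fun z => f (z.1, cons_tuple r z.2))) => //.
  apply: (measurableT_comp mf); apply/measurable_fun_pair => //=.
  by apply: measurable_cons => //; exact: measurable_cst.
apply: (slice_integral_swap _ (fun z : R * R =>
  cube_int n (fun y => f (z.2, cons_tuple z.1 y)))) => //; last first.
  by move=> z; exact: cube_int_ge0.
apply: (measurable_cube_int _ _ _ (fun z : (R * R) * n.-tuple R =>
  f (z.1.2, cons_tuple z.1.1 z.2))).
apply: (measurableT_comp mf); apply/measurable_fun_pair => //=.
  exact: measurableT_comp.
by apply: measurable_cons => //; exact: measurableT_comp.
Qed.

(** Tonelli for two cubes: the coordinates of the second cube are pulled outside one at a time. *)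
Lemma cube_int_swap m n (f : m.-tuple R * n.-tuple R -> \bar R) :
  measurable_fun setT f -> (forall z, 0 <= f z) ->
  cube_int m (fun x => cube_int n (fun t => f (x, t))) =
  cube_int n (fun t => cube_int m (fun x => f (x, t))).
Proof.
elim: n f => [|n IH] f mf f0 //=.
rewrite (cube_int_integral_swap _ (fun z =>
  cube_int n (fun y => f (z.2, cons_tuple z.1 y)))); last 2 first.
- apply: (measurable_cube_int _ _ _ (fun z : (R * m.-tuple R) * n.-tuple R =>
    f (z.1.2, cons_tuple z.1.1 z.2))).
  apply: (measurableT_comp mf); apply/measurable_fun_pair => //=.
    exact: measurableT_comp.
  by apply: measurable_cons => //; exact: measurableT_comp.
- by move=> z; exact: cube_int_ge0.
apply: eq_integral => s _.
apply: (IH (fun z => f (z.1, cons_tuple s z.2))) => //.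
apply: (measurableT_comp mf); apply/measurable_fun_pair => //=.
by apply: measurable_cons => //; exact: measurable_cst.
Qed.

End CubeIntegral.

(** * Sums of products of univariate functions *)

Section BoundedMeasurable.
Context {R : realType}.
Local Notation mu := (@lebesgue_measure R).
Local Notation I01 := (`[0%R, 1%R]%classic : set R).

Definition int01 (f : R -> R) : R := \int[mu]_(s in I01) f s.

(** A class stable under sums, products, powers, absolute values and [primitive], with finite
    integrals over the unit interval; it keeps the univariate computations in [R] instead of
    [\bar R]. *)
Definition bounded_mfun (f : R -> R) :=
  measurable_fun setT f /\ exists M, forall x, `|f x| <= M.

Definition primitive (f : R -> R) (x : R) : R :=
  int01 (fun s => f s * (s <= x)%R%:R).

(** The weight dual to [primitive]: by Tonelli, integrating [primitive f] over the unit interval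
    pairs [f] with [tail]. It is [1 - s] on the unit interval, and in this form it stays between 0
    and 1 for every real [s]. *)
Definition tail (s : R) : R := int01 (fun x => (s <= x)%R%:R).

Lemma lebesgue_measure01 : mu I01 = 1%E.
Proof. by rewrite lebesgue_measure_itv/= lte_fin ltr01 oppr0 adde0. Qed.

Lemma bounded_mfun_cst k : bounded_mfun (fun=> k).
Proof. by split; [exact: measurable_cst | exists `|k|]. Qed.

Lemma bounded_mfunD f g :
  bounded_mfun f -> bounded_mfun g -> bounded_mfun (fun x => f x + g x).
Proof.
move=> [mf [M fM]] [mg [M' gM]]; split; first exact: measurable_funD.
by exists (M + M') => x; apply: le_trans (ler_normD _ _) _; exact: lerD.
Qed.

Lemma bounded_mfunM f g :
  bounded_mfun f -> bounded_mfun g -> bounded_mfun (fun x => f x * g x).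
Proof.
move=> [mf [M fM]] [mg [M' gM]]; split; first exact: measurable_funM.
by exists (M * M') => x; rewrite normrM ler_pM.
Qed.

Lemma bounded_mfunX f n : bounded_mfun f -> bounded_mfun (fun x => f x ^+ n).
Proof.
move=> bf; elim: n => [|n IH]; first exact: bounded_mfun_cst.
by under eq_fun do rewrite exprS; exact: bounded_mfunM.
Qed.

Lemma bounded_mfun_norm f : bounded_mfun f -> bounded_mfun (fun x => `|f x|).
Proof.
move=> [mf [M fM]]; split; first exact: measurableT_comp.
by exists M => x; rewrite normr_id.
Qed.

Lemma measurable_ler_indicator d (T : measurableType d) (f g : T -> R) :
  measurable_fun setT f -> measurable_fun setT g ->
  measurable_fun setT (fun x => (f x <= g x)%R%:R : R).
Proof.
move=> mf mg; rewrite (_ : (fun x => _) = fun x => if f x <= g x then 1 else 0).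
  by apply: measurable_fun_ifT => //; exact: measurable_fun_ler.
by apply/funext => x; case: ifP.
Qed.

Lemma bounded_mfun_ler (f g : R -> R) : measurable_fun setT f -> measurable_fun setT g ->
  bounded_mfun (fun x => (f x <= g x)%R%:R).
Proof.
move=> mf mg; split; first exact: measurable_ler_indicator.
by exists 1 => x; rewrite normr_nat lern1 leq_b1.
Qed.

Lemma bounded_mfun_integrable f :
  bounded_mfun f -> mu.-integrable I01 (EFin \o f).
Proof.
move=> [mf [M fM]]; apply: measurable_bounded_integrable => //.
- by rewrite [ltLHS]lebesgue_measure01 ltry.
- exact: measurable_funTS.
- exists M; split; first exact: num_real.
  by move=> A MA x _ /=; apply: le_trans (fM x) (ltW MA).
Qed.

Lemma int01_cst (k : R) : int01 (fun=> k) = k.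
Proof. by rewrite /int01 Rintegral_cst// [X in fine X]lebesgue_measure01 mulr1. Qed.

Lemma le_int01 f g : bounded_mfun f -> bounded_mfun g ->
  (forall s, 0 <= s <= 1 -> f s <= g s) -> int01 f <= int01 g.
Proof.
move=> bf bg fg; apply: le_Rintegral => //.
- exact: bounded_mfun_integrable.
- exact: bounded_mfun_integrable.
Qed.

Lemma int01D f g : bounded_mfun f -> bounded_mfun g ->
  int01 (fun s => f s + g s) = int01 f + int01 g.
Proof.
by move=> bf bg; apply: RintegralD => //; exact: bounded_mfun_integrable.
Qed.

Lemma int01Zl k f : bounded_mfun f ->
  int01 (fun s => k * f s) = k * int01 f.
Proof.
by move=> bf; apply: RintegralZl => //; exact: bounded_mfun_integrable.
Qed.

Lemma EFin_int01 f : bounded_mfun f ->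
  (int01 f)%:E = (\int[mu]_(s in I01) (f s)%:E)%E.
Proof.
by move=> bf; rewrite /int01 fineK//; apply: integrable_fin_num => //;
  exact: bounded_mfun_integrable.
Qed.

Lemma bounded_mfun_primitive f : bounded_mfun f -> bounded_mfun (primitive f).
Proof.
move=> bf; have bfi x : bounded_mfun (fun s => f s * (s <= x)%R%:R).
  by apply: bounded_mfunM => //; exact: bounded_mfun_ler.
have [mf [M fM]] := bf; split.
  rewrite (_ : primitive f = fine \o
      (fun x => \int[mu]_(s in I01) (f s * (s <= x)%R%:R)%:E)%E)//.
  apply: measurableT_comp => //.
  apply: (measurable_slice_integral _ _ _
    (fun z : R * R => (f z.2 * (z.2 <= z.1)%R%:R)%:E)) => //.
  apply/measurable_EFinP; apply: measurable_funM; first exact: measurableT_comp.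
  exact: measurable_ler_indicator.
exists M => x; rewrite /primitive.
apply: (@le_trans _ _ (int01 (fun s => `|f s * (s <= x)%R%:R|))).
  by apply: le_normr_Rintegral => //; exact: bounded_mfun_integrable.
rewrite -[leRHS]int01_cst; apply: le_int01.
- exact: bounded_mfun_norm.
- exact: bounded_mfun_cst.
- move=> s _; rewrite normrM normr_nat; apply: le_trans (fM s).
  by rewrite ler_piMr// lern1 leq_b1.
Qed.

Lemma bounded_mfun_tail : bounded_mfun tail.
Proof.
split.
  rewrite (_ : tail = fine \o
      (fun s => \int[mu]_(x in I01) ((s <= x)%R%:R)%:E)%E)//.
  apply: measurableT_comp => //.
  apply: (measurable_slice_integral _ _ _
    (fun z : R * R => ((z.1 <= z.2)%R%:R)%:E)) => //.
  by apply/measurable_EFinP; exact: measurable_ler_indicator.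
exists 1 => s; rewrite ger0_norm; last exact: Rintegral_ge0.
rewrite -[leRHS]int01_cst; apply: le_int01.
- exact: bounded_mfun_ler.
- exact: bounded_mfun_cst.
- by move=> x _; rewrite lern1 leq_b1.
Qed.

Lemma primitiveD f g : bounded_mfun f -> bounded_mfun g ->
  primitive (fun s => f s + g s) = (fun x => primitive f x + primitive g x).
Proof.
move=> bf bg; apply/funext => x; rewrite /primitive.
under eq_fun do rewrite mulrDl.
by apply: int01D; apply: bounded_mfunM => //; exact: bounded_mfun_ler.
Qed.

Let int01_primitive_ge0 f : bounded_mfun f -> (forall s, 0 <= f s) ->
  int01 (primitive f) = int01 (fun s => f s * tail s).
Proof.
move=> bf f0; have [mf _] := bf; apply: EFin_inj.
pose h (z : R * R) : \bar R := (f z.2 * (z.2 <= z.1)%R%:R)%:E.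
have mh : measurable_fun setT h.
  apply/measurable_EFinP; apply: measurable_funM; first exact: measurableT_comp.
  exact: measurable_ler_indicator.
have h0 z : (0 <= h z)%E by rewrite lee_fin mulr_ge0.
have bl s : bounded_mfun (fun x => (s <= x)%R%:R) by exact: bounded_mfun_ler.
have bl' x : bounded_mfun (fun s => (s <= x)%R%:R) by exact: bounded_mfun_ler.
rewrite EFin_int01; last exact: bounded_mfun_primitive.
rewrite EFin_int01; last by apply: bounded_mfunM => //; exact: bounded_mfun_tail.
transitivity (\int[mu]_(x in I01) \int[mu]_(s in I01) h (x, s))%E.
  by apply: eq_integral => x _; rewrite EFin_int01//; exact: bounded_mfunM.
rewrite slice_integral_swap//; apply: eq_integral => s _.
by rewrite -int01Zl// EFin_int01//; apply: bounded_mfunM => //;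
  exact: bounded_mfun_cst.
Qed.

(** The nonnegative case is applied to [f + M] and to the constant [M]; linearity cancels the
    latter. *)
Lemma int01_primitive f : bounded_mfun f ->
  int01 (primitive f) = int01 (fun s => f s * tail s).
Proof.
move=> bf; have [mf [M fM]] := bf.
have bM := bounded_mfun_cst M; have bt := bounded_mfun_tail.
have M0 : 0 <= M by exact: le_trans (normr_ge0 _) (fM 0).
have fM0 s : 0 <= f s + M.
  by rewrite -lerBlDr sub0r; have := fM s; rewrite ler_norml => /andP[].
have := int01_primitive_ge0 _ (bounded_mfunD _ _ bf bM) fM0.
rewrite primitiveD// int01D; [|exact: bounded_mfun_primitive..].
rewrite (int01_primitive_ge0 _ bM)// => /eqP.
under [X in _ == int01 X]eq_fun do rewrite mulrDl.
rewrite int01D; [|exact: bounded_mfunM..].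
by rewrite (inj_eq (addIr _)) => /eqP.
Qed.

Lemma cube_int_sum_prod (I : finType) (P : pred I) d (c : I -> R)
    (f : I -> 'I_d -> R -> R) :
  (forall i j, bounded_mfun (f i j)) ->
  cube_int d (fun t => (\sum_(i | P i) c i * \prod_j f i j (tnth t j))%:E) =
  (\sum_(i | P i) c i * \prod_j int01 (f i j))%:E.
Proof.
elim: d c f => [|d IH] c f bf /=.
  by congr EFin; apply: eq_bigr => i _; rewrite !big_ord0.
(* The factor in the first coordinate joins the coefficient, so the induction hypothesis applies
   with coefficients depending on [s]. *)
pose g s i := c i * f i ord0 s.
transitivity (\int[mu]_(s in I01) (\sum_(i | P i) (g s i *
    \prod_j int01 (f i (lift ord0 j))))%:E)%E.
  apply: eq_integral => s _; rewrite -(IH (g s)) //.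
  congr cube_int; apply/funext => y; congr EFin; apply: eq_bigr => i _.
  rewrite big_ord_recl tnth0 mulrA; congr (_ * _).
  by apply: eq_bigr => j _; rewrite tnthS.
under eq_integral do rewrite -sumEFin.
have bg i : bounded_mfun (fun s => g s i * \prod_j int01 (f i (lift ord0 j))).
  apply: bounded_mfunM; last exact: bounded_mfun_cst.
  by apply: bounded_mfunM => //; exact: bounded_mfun_cst.
rewrite (integral_sum _ (fun i => bounded_mfun_integrable _ (bg i)))//.
rewrite -sumEFin; apply: eq_bigr => i _.
rewrite -EFin_int01// big_ord_recl mulrA -int01Zl// mulrC -int01Zl//; last first.
  by apply: bounded_mfunM => //; exact: bounded_mfun_cst.
by congr (int01 _)%:E; apply/funext => s; rewrite mulrC.
Qed.

Lemma cube_int_prod d (c : R) (f : 'I_d -> R -> R) :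
  (forall j, bounded_mfun (f j)) ->
  cube_int d (fun t => (c * \prod_j f j (tnth t j))%:E) =
  (c * \prod_j int01 (f j))%:E.
Proof.
move=> bf; have E (F : unit -> R) : \sum_i F i = F tt by rewrite (big_pred1 tt)//; case.
have := cube_int_sum_prod unit predT d (fun=> c) (fun _ => f) (fun _ => bf).
by rewrite E => <-; congr cube_int; apply/funext => t; rewrite E.
Qed.

Lemma box_belowE d (x t : d.-tuple R) :
  (box_below d x t)%:R = \prod_j (tnth t j <= tnth x j)%R%:R :> R.
Proof.
rewrite /box_below; case: forallP => [tx|/forallP]; last first.
  by rewrite negb_forall => /existsP[j /negbTE jx]; rewrite (bigD1 j)//= jx mul0r.
by rewrite big1// => j _; rewrite tx.
Qed.

(** The indicator of a box is a product of indicators, hence the primitive of a tensor product is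
    the tensor product of the primitives. *)
Lemma F_of_sum_prod (I : finType) (P : pred I) d (c : I -> R)
    (f : I -> 'I_d -> R -> R) :
  (forall i j, bounded_mfun (f i j)) ->
  F_of d (fun t => \sum_(i | P i) c i * \prod_j f i j (tnth t j)) =
  (fun x => \sum_(i | P i) c i * \prod_j primitive (f i j) (tnth x j)).
Proof.
move=> bf; apply/funext => x; rewrite /F_of.
rewrite (_ : (fun t => _) = (fun t => (\sum_(i | P i) c i *
    \prod_j (f i j (tnth t j) * (tnth t j <= tnth x j)%R%:R))%:E)).
  rewrite (cube_int_sum_prod _ P _ c
    (fun i j s => f i j s * (s <= tnth x j)%R%:R))// => i j.
  by apply: bounded_mfunM => //; exact: bounded_mfun_ler.
apply/funext => t; congr EFin; rewrite mulr_suml; apply: eq_bigr => i _.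
by rewrite big_split/= mulrA box_belowE.
Qed.

Lemma I_d_F_of_sum_prod (I : finType) (P : pred I) d (c : I -> R)
    (f : I -> 'I_d -> R -> R) :
  (forall i j, bounded_mfun (f i j)) ->
  I_d d (F_of d (fun t => \sum_(i | P i) c i * \prod_j f i j (tnth t j))) =
  \sum_(i | P i) c i * \prod_j int01 (fun s => f i j s * tail s).
Proof.
move=> bf; rewrite /I_d F_of_sum_prod//.
rewrite (cube_int_sum_prod _ P _ c (fun i j => primitive (f i j)))/=.
  apply: eq_bigr => i _; congr (_ * _); apply: eq_bigr => j _.
  exact: int01_primitive.
by move=> i j; exact: bounded_mfun_primitive.
Qed.

Lemma measurable_sum_prod (I : finType) (P : pred I) d (c : I -> R)
    (f : I -> 'I_d -> R -> R) :
  (forall i j, measurable_fun setT (f i j)) ->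
  measurable_fun setT (fun t : d.-tuple R =>
    \sum_(i | P i) c i * \prod_j f i j (tnth t j)).
Proof.
move=> mf; under eq_fun do rewrite big_mkcond/=.
apply: measurable_sum => i; case: (P i); last exact: measurable_cst.
apply: measurable_funM => //; apply: measurable_prod => j _.
by apply: measurableT_comp => //; exact: measurable_tnth.
Qed.

End BoundedMeasurable.

(** * The univariate decomposition *)

Section OneDimension.
Context {R : realType}.
Local Notation mu := (@lebesgue_measure R).
Local Notation I01 := (`[0%R, 1%R]%classic : set R).

Lemma int01_le_cut (x : R) : 0 <= x <= 1 ->
  int01 (fun s => (s <= x)%R%:R) = x.
Proof.
move=> /andP[x0 x1]; apply: EFin_inj.
rewrite EFin_int01; last exact: bounded_mfun_ler.
transitivity (\int[mu]_(s in I01) (\1_(`]-oo, x]%classic) s)%:E)%E.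
  by apply: eq_integral => s _; rewrite indicE mem_setE in_itv.
rewrite integral_indic//.
rewrite (_ : _ `&` _ = `[0, x]%classic); last first.
  apply/seteqP; split=> s /=; rewrite !in_itv/=; first by move=> [? /andP[-> _]].
  by move=> /andP[-> sx]; rewrite sx (le_trans sx).
rewrite [LHS]lebesgue_measure_itv/= lte_fin oppr0 adde0.
by case: ltP => // xx; congr EFin; apply/eqP; rewrite eq_le x0 xx.
Qed.

Lemma tailE (s : R) : 0 <= s <= 1 -> tail s = 1 - s.
Proof.
move=> /andP[s0 s1]; apply: EFin_inj.
rewrite /tail EFin_int01; last exact: bounded_mfun_ler.
transitivity (\int[mu]_(x in I01) (\1_(`[s, +oo[%classic) x)%:E)%E.
  by apply: eq_integral => x _; rewrite indicE mem_setE in_itv/= andbT.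
rewrite integral_indic//.
rewrite (_ : _ `&` _ = `[s, 1]%classic); last first.
  apply/seteqP; split=> x /=; rewrite !in_itv/= ?andbT.
    by move=> [-> /andP[_ ->]].
  by move=> /andP[sx ->]; rewrite sx (le_trans s0).
rewrite [LHS]lebesgue_measure_itv/= lte_fin.
by case: ltP => // ss; have -> : s = 1; [apply/eqP; rewrite eq_le s1 | rewrite subrr].
Qed.

Lemma tail_ge0 (s : R) : 0 <= tail s.
Proof. exact: Rintegral_ge0. Qed.

(** A second order Taylor bound, with [y] of either sign. Multiplying by [x + y] in the induction
    reproduces the first two terms exactly, and the crude constant [4 ^+ n.+1] absorbs the rest
    because 1 + 2 <= 4. *)
Lemma exprD_le_tangent (x y : R) n : 0 <= x <= 1 -> 0 <= x + y <= 2 ->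
  (x + y) ^+ n.+1 <= x ^+ n.+1 + n.+1%:R * y * x ^+ n + 4 ^+ n.+1 * y ^+ 2.
Proof.
move=> /andP[x0 x1] /andP[xy0 xy2]; elim: n => [|n IH].
  rewrite !expr1 expr0; have := sqr_ge0 y; lra.
rewrite exprS; apply: (le_trans (ler_wpM2l xy0 IH)).
have xn : x ^+ n <= 1 by rewrite exprn_ile1.
have n4 : (n.+1%:R : R) <= 4 ^+ n.+1.
  by rewrite -natrX ler_nat; apply: ltnW; apply: ltn_expl.
have h : n.+1%:R * x ^+ n + 4 ^+ n.+1 * (x + y) <= 4 ^+ n.+2.
  have p4 : (0 : R) <= 4 ^+ n.+1 by rewrite exprn_ge0.
  have a1 : n.+1%:R * x ^+ n <= 4 ^+ n.+1.
    by apply: le_trans n4; rewrite ler_piMr.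
  have a2 : 4 ^+ n.+1 * (x + y) <= 4 ^+ n.+1 * 2 by rewrite ler_wpM2l.
  rewrite [4 ^+ n.+2]exprS; lra.
have := ler_wpM2r (sqr_ge0 y) h.
rewrite -subr_ge0 => h'; rewrite -subr_ge0; apply: le_trans h' _.
rewrite le_eqVlt; apply/orP; left; apply/eqP.
rewrite -[n.+2%:R]natr1 !exprS; ring.
Qed.

(* On [[0, 1]] this is [(1 - s) ^ (1 / (q - 1))], the equality case of Hoelder's
   inequality for the pairing with [tail]. *)
Definition extremal (q : nat) (s : R) : R := tail s `^ (q.-1%:R)^-1.

(** For [1 < q] this is at once the q-th power of the L_q norm of [extremal q] and its pairing with
    [tail], since the two integrands agree. *)
Definition extremal_mass (q : nat) : R := int01 (fun s => extremal q s ^+ q).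

Lemma extremal_ge0 q s : 0 <= extremal q s.
Proof. exact: powR_ge0. Qed.

Lemma extremalX q s : (1 < q)%N -> extremal q s ^+ q.-1 = tail s.
Proof.
move=> q1; rewrite /extremal -powR_mulrn ?powR_ge0// -powRrM mulVf; last first.
  by rewrite pnatr_eq0; case: q q1 => [|[]].
by rewrite powRr1// tail_ge0.
Qed.

Lemma tail_le1 (s : R) : tail s <= 1.
Proof.
rewrite -[leRHS](@int01_cst R); apply: le_int01.
- exact: bounded_mfun_ler.
- exact: bounded_mfun_cst.
- by move=> x _; rewrite lern1 leq_b1.
Qed.

Lemma extremal_le1 q s : extremal q s <= 1.
Proof.
have <- : 1 `^ (q.-1%:R^-1) = 1 :> R by rewrite powR1.
by apply: ge0_ler_powR; rewrite ?nnegrE ?invr_ge0// ?tail_ge0 ?tail_le1.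
Qed.

(** [tail] is the power q - 1 >= 1 of a number in the unit interval. This gives lower bounds on
    [extremal] without handling real exponents. *)
Lemma tail_le_extremal q s : (1 < q)%N -> tail s <= extremal q s.
Proof.
move=> q1; rewrite -(extremalX q)//; case: q q1 => [|[|q]]// _.
by rewrite /= exprS ler_piMr ?extremal_ge0// exprn_ile1 ?extremal_ge0 ?extremal_le1.
Qed.

Lemma bounded_mfun_extremal q : bounded_mfun (extremal q).
Proof.
split.
  apply: (@measurableT_comp _ _ _ _ _ _ (@powR R ^~ (q.-1%:R^-1))).
    exact: measurable_powR.
  by have [] := @bounded_mfun_tail R.
by exists 1 => s; rewrite ger0_norm ?extremal_ge0 ?extremal_le1.
Qed.

(** A Haar step: -1 up to 1/4, then 1 up to 1/2, then 0. Its mean over the unit interval is zero,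
    yet its pairing with the decreasing weight [tail] is negative. *)
Definition haar (s : R) : R := (s <= 2^-1)%R%:R - 2 * (s <= 4^-1)%R%:R.

Lemma bounded_mfun_haar : bounded_mfun haar.
Proof.
rewrite /haar; under eq_fun do rewrite -mulNr.
apply: bounded_mfunD; first exact: bounded_mfun_ler.
by apply: bounded_mfunM; [exact: bounded_mfun_cst | exact: bounded_mfun_ler].
Qed.

Lemma int01_haar : int01 haar = 0.
Proof.
rewrite /haar; under [in LHS]eq_fun do rewrite -mulNr.
have b (x : R) : bounded_mfun (fun s => (s <= x)%R%:R) by exact: bounded_mfun_ler.
rewrite int01D//; last by apply: bounded_mfunM => //; exact: bounded_mfun_cst.
rewrite int01Zl// !int01_le_cut; lra.
Qed.

Lemma haar_cases s :
  [\/ (s <= 4^-1 /\ haar s = -1), (4^-1 < s <= 2^-1 /\ haar s = 1) |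
      (2^-1 < s /\ haar s = 0)].
Proof.
rewrite /haar; case: (leP s 4^-1) => h1.
  have -> : s <= 2^-1 by lra.
  by constructor 1; split => //=; lra.
case: (leP s 2^-1) => h2; first by constructor 2; split => //=; lra.
by constructor 3; split => //=; lra.
Qed.

Lemma int01_haar_tail : int01 (fun s => haar s * tail s) <= - 64^-1.
Proof.
have b (x : R) : bounded_mfun (fun s => (s <= x)%R%:R) by exact: bounded_mfun_ler.
have c k (f : R -> R) : bounded_mfun f -> bounded_mfun (fun s => k * f s).
  by move=> bf; apply: bounded_mfunM => //; exact: bounded_mfun_cst.
(* Here 3/4 is the value of [1 - s] at the sign change s = 1/4, so [haar s * (1/4 - s)] is
   nonpositive, and at most -1/8 for s <= 1/8. The mean of [haar] vanishes, which leaves -1/8 times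
   1/8. *)
apply: (@le_trans _ _ (int01 (fun s => 3/4 * haar s + - 8^-1 * (s <= 8^-1)%R%:R))).
  apply: le_int01.
  - by apply: bounded_mfunM; [exact: bounded_mfun_haar | exact: bounded_mfun_tail].
  - by apply: bounded_mfunD; apply: c => //; exact: bounded_mfun_haar.
  - move=> s s01; rewrite tailE//.
    case: (haar_cases s) => -[hs ->]; case: (leP s 8^-1) => h8 /=; lra.
rewrite int01D; [|by apply: c => //; exact: bounded_mfun_haar|exact: c].
rewrite !int01Zl//; last exact: bounded_mfun_haar.
rewrite int01_haar int01_le_cut; lra.
Qed.

End OneDimension.

(** * The three pieces and their strict loss in moment and norm *)

Section Pieces.
Context {R : realType}.
Variable q : nat.
Hypothesis q1 : (1 < q)%N.
Local Notation g := (@extremal R q).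
Local Notation mass := (@extremal_mass R q).
Local Notation e := (fun s : R => (s <= 2^-1)%R%:R).

(* The primitive of [piece (Some true)] vanishes left of 1/2 and that of
   [piece (Some false)] right of 1/2, so a node coordinate is blind to one of
   the two.  Moving [eta * haar] into [piece None] costs [Some false] only
   O(eta), but lowers the L_q norm of [None] + [Some true] strictly below that
   of [extremal], because [haar] is not orthogonal to [tail]. *)
Definition piece (eta : R) (i : option bool) (s : R) : R :=
  match i with
  | None => g s * e s + eta * haar s
  | Some false => - (eta * haar s)
  | Some true => g s * (1 - e s)
  end.

Lemma sum_piece eta s :
  piece eta None s + (piece eta (Some true) s + piece eta (Some false) s) = g s.
Proof. by rewrite /piece; ring. Qed.

Let be : bounded_mfun e. Proof. exact: bounded_mfun_ler. Qed.
Let bg : bounded_mfun g. Proof. exact: bounded_mfun_extremal. Qed.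
Let bh : bounded_mfun (@haar R). Proof. exact: bounded_mfun_haar. Qed.
Let bt : bounded_mfun (@tail R). Proof. exact: bounded_mfun_tail. Qed.
Let bc (k : R) : bounded_mfun (fun=> k). Proof. exact: bounded_mfun_cst. Qed.
Let bZ k (f : R -> R) : bounded_mfun f -> bounded_mfun (fun s => k * f s).
Proof. by move=> bf; apply: bounded_mfunM. Qed.
Let bN (f : R -> R) : bounded_mfun f -> bounded_mfun (fun s => - f s).
Proof. by move=> bf; under eq_fun do rewrite -mulN1r; exact: bZ. Qed.
Let b1e : bounded_mfun (fun s => 1 - e s).
Proof. by apply: bounded_mfunD => //; exact: bN. Qed.

Lemma bounded_mfun_piece eta i : bounded_mfun (piece eta i).
Proof.
case: i => [[]|] /=; first exact: bounded_mfunM.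
  by apply: bN; exact: bZ.
by apply: bounded_mfunD; [exact: bounded_mfunM | exact: bZ].
Qed.

(** Left of 1/2 the integrand is zero pointwise; from 1/2 on the cutoff no longer affects [haar],
    whose mean is zero. *)
Lemma primitive_piece eta x : primitive (piece eta (Some (x < 2^-1))) x = 0.
Proof.
rewrite /primitive; case: (ltP x 2^-1) => hx.
  rewrite [X in int01 X](_ : _ = fun=> 0) ?int01_cst//.
  apply/funext => s /=; case: (leP s x) => sx; rewrite ?mulr0//.
  have -> /= : s <= 2^-1 by lra.
  by rewrite subrr !(mulr0, mul0r).
rewrite [X in int01 X](_ : _ = fun s => - eta * haar s); last first.
  apply/funext => s /=; case: (leP s x) => sx; rewrite ?mulr1 ?mulNr//.
  by case: (haar_cases s) => -[hs ->]; rewrite ?mulr0 ?oppr0//; exfalso; lra.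
by rewrite int01Zl// int01_haar mulr0.
Qed.

Lemma extremal_ge_half s : 0 <= s <= 2^-1 -> 2^-1 <= g s.
Proof.
move=> hs; apply: le_trans (tail_le_extremal q s q1).
by rewrite tailE; lra.
Qed.

(** Nonnegative moments make the absolute values in the union bound harmless. The piece [None] is
    nonnegative on the unit interval because [extremal] is at least 1/2 where [haar] is nonzero; for
    [Some false] the sign comes from [int01_haar_tail]. *)
Lemma piece_tail_ge0 eta i : 0 <= eta <= 2^-1 ->
  0 <= int01 (fun s => piece eta i s * tail s).
Proof.
move=> heta; case: i => [[]|]; last 1 first.
- rewrite -[leLHS](@int01_cst R); apply: le_int01 => //.
    by apply: bounded_mfunM => //; exact: bounded_mfun_piece.
  move=> s s01 /=; rewrite mulr_ge0 ?tail_ge0//.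
  have g0 := extremal_ge0 q s.
  case: (leP s 2^-1) => s2 /=.
    have := extremal_ge_half s; rewrite s2 andbT => /(_ (andP s01).1) gs.
    by case: (haar_cases s) => -[hs ->]; lra.
  by case: (haar_cases s) => -[hs ->]; lra.
- rewrite -[leLHS](@int01_cst R); apply: le_int01 => //.
    by apply: bounded_mfunM => //; exact: bounded_mfun_piece.
  move=> s s01 /=; rewrite !mulr_ge0 ?tail_ge0 ?extremal_ge0//.
  by rewrite subr_ge0 lern1 leq_b1.
- rewrite [X in int01 X](_ : _ = fun s => - eta * (haar s * tail s)); last first.
    by apply/funext => s /=; ring.
  rewrite int01Zl; last exact: bounded_mfunM.
  have := @int01_haar_tail R; nra.
Qed.

Lemma extremalS s : g s ^+ q = g s * tail s.
Proof. by rewrite -(extremalX q s q1) -exprS (ltn_predK q1). Qed.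

Let low : R := int01 (fun s => g s ^+ q * e s).
Let high : R := int01 (fun s => g s ^+ q * (1 - e s)).

Lemma extremal_mass_split : mass = low + high.
Proof.
rewrite /low /high -int01D.
- by congr int01; apply/funext => s; ring.
- by apply: bounded_mfunM => //; exact: bounded_mfunX.
- by apply: bounded_mfunM => //; exact: bounded_mfunX.
Qed.

(** On (1/2, 3/4], an interval of length 1/4, [extremal] is at least [tail] and hence at least
    1/4. *)
Lemma high_ge : (4^-1 : R) ^+ q * 4^-1 <= high.
Proof.
have h : int01 (fun s : R => (4^-1) ^+ q * ((s <= 3/4)%R%:R + - 1 * (s <= 2^-1)%R%:R))
    = (4^-1) ^+ q * 4^-1.
  have b (x : R) : bounded_mfun (fun s => (s <= x)%R%:R) by exact: bounded_mfun_ler.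
  rewrite int01Zl; last by apply: bounded_mfunD => //; exact: bZ.
  rewrite int01D//; last exact: bZ.
  rewrite int01Zl// !int01_le_cut; [|lra..].
  congr (_ * _); lra.
rewrite -h; apply: le_int01.
- apply: bZ; apply: bounded_mfunD; first exact: bounded_mfun_ler.
  by apply: bZ.
- by apply: bounded_mfunM => //; exact: bounded_mfunX.
- move=> s s01; have p0 : 0 <= g s ^+ q by rewrite exprn_ge0 ?extremal_ge0.
  case: (leP s 2^-1) => s2 /=.
    have -> /= : s <= 3/4 by lra.
    by rewrite mulr1 subrr !mulr0.
  case: (leP s (3/4)) => s3 /=; last by rewrite mulr0 addr0 subr0 mulr0 mulr1.
  have g4 : 4^-1 <= g s.
    by apply: le_trans (tail_le_extremal q s q1); rewrite tailE; lra.
  rewrite mulr0 addr0 subr0 !mulr1.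
  by apply: lerXn2r; rewrite // nnegrE ?extremal_ge0// invr_ge0.
Qed.

Lemma extremal_mass_gt : (4^-1 : R) ^+ q * 4^-1 <= mass.
Proof.
rewrite extremal_mass_split; apply: le_trans high_ge _.
rewrite lerDr -[leLHS](@int01_cst R); apply: le_int01 => //.
  by apply: bounded_mfunM => //; exact: bounded_mfunX.
by move=> s _; rewrite mulr_ge0// exprn_ge0 ?extremal_ge0.
Qed.

Lemma extremal_mass_gt0 : 0 < mass.
Proof.
by apply: lt_le_trans extremal_mass_gt; rewrite mulr_gt0 ?exprn_gt0 ?invr_gt0.
Qed.

(** Small in two respects: [4 ^+ q * eta] is at most 1/256, so quadratic errors lose against the
    linear gain from [haar], and [q%:R * eta] is 4^-q / 128, so the perturbation of the left half
    costs less than the mass [high] of the right half. *)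
Definition eta : R := (4^-1) ^+ q / (128 * q%:R).

Lemma eta_gt0 : 0 < eta.
Proof. by rewrite divr_gt0 ?exprn_gt0// mulr_gt0// ltr0n ltnW. Qed.

Let q2 : (2 : R) <= q%:R. Proof. by rewrite (ler_nat _ 2). Qed.

Let q_eta : q%:R * eta = (4^-1) ^+ q / 128.
Proof.
have q0 : q%:R != 0 :> R by rewrite pnatr_eq0 -lt0n ltnW.
by rewrite /eta; field; rewrite ?q0 ?expf_neq0.
Qed.

Let eta_small : 4 ^+ q * eta <= 256^-1.
Proof.
rewrite /eta mulrA -exprMn divff// expr1n mul1r.
have q2' := q2; rewrite lef_pV2 ?posrE; lra.
Qed.

Let u_le1 : (4^-1 : R) ^+ q <= 1. Proof. by rewrite exprn_ile1//; lra. Qed.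

Let eta_le : eta <= 256^-1.
Proof.
have q2' := q2; have u1 := u_le1.
rewrite /eta ler_pdivrMr; last lra.
lra.
Qed.

Lemma eta_itv : 0 <= eta <= 2^-1.
Proof. by have := eta_gt0; have := eta_le; lra. Qed.

Lemma eta_le_pow : 256 * eta <= (4^-1) ^+ q.
Proof. by have := ler_wpM2r (ltW eta_gt0) q2; rewrite q_eta; lra. Qed.

(** For [b = true] the two pieces add up to [g + eta * haar], and [haar] pairs negatively with
    [tail]. For [b = false] they add up to the left half of [g], and the mass [high] is lost. *)
Lemma piece_moment_le b :
  int01 (fun s => piece eta None s * tail s) +
  int01 (fun s => piece eta (Some b) s * tail s) <= mass - eta / 128.
Proof.
have bp i : bounded_mfun (fun s => piece eta i s * tail s).
  by apply: bounded_mfunM => //; exact: bounded_mfun_piece.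
rewrite -int01D//; case: b.
- rewrite [X in int01 X](_ : _ = fun s => g s ^+ q + eta * (haar s * tail s)).
    have bht := bounded_mfunM _ _ bh bt.
    rewrite int01D; [|exact: bounded_mfunX|exact: bZ].
    rewrite int01Zl// -/mass; have := @int01_haar_tail R.
    by have := eta_gt0; nra.
  by apply/funext => s; rewrite extremalS /piece; ring.
- rewrite [X in int01 X](_ : _ = fun s => g s ^+ q * e s); last first.
    by apply/funext => s; rewrite extremalS /piece; ring.
  rewrite extremal_mass_split -/low; have := high_ge.
  have := eta_le_pow; have := eta_gt0; lra.
Qed.

Lemma piece_power_le b :
  int01 (fun s => (`|piece eta None s| + `|piece eta (Some b) s|) ^+ q)
  <= mass - eta / 128.
Proof.
have bp i : bounded_mfun (fun s => `|piece eta i s|).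
  by apply: bounded_mfun_norm; exact: bounded_mfun_piece.
have tangent (x y : R) : 0 <= x <= 1 -> 0 <= x + y <= 2 ->
    (x + y) ^+ q <= x ^+ q + q%:R * y * x ^+ q.-1 + 4 ^+ q * y ^+ 2.
  by move=> hx hy; have := exprD_le_tangent x y q.-1 hx hy; rewrite (ltn_predK q1).
have gs01 s : 0 <= g s <= 1 by rewrite extremal_ge0 extremal_le1.
have gq0 s : 0 <= g s ^+ q by rewrite exprn_ge0 ?extremal_ge0.
have bgq : bounded_mfun (fun s => g s ^+ q) by exact: bounded_mfunX.
have bht := bounded_mfunM _ _ bh bt.
have p4 : 0 <= 4 ^+ q :> R by rewrite exprn_ge0.
have e0 := eta_gt0; have es := eta_small; have el := eta_le.
have gh s : 0 <= s <= 1 -> s <= 2^-1 -> 2^-1 <= g s.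
  by move=> /andP[s0 _] s2; apply: extremal_ge_half; rewrite s0.
case: b.
(* The two pieces do not overlap and are nonnegative on the unit interval, so the base is
   [g + eta * haar]. In the tangent bound [g ^+ q.-1] is [tail]: the linear term is at most -eta/32
   since q >= 2, the quadratic one at most eta/256. *)
- apply: (@le_trans _ _ (int01 (fun s =>
    g s ^+ q + (q%:R * eta * (haar s * tail s) + 4 ^+ q * eta ^+ 2)))).
    apply: le_int01.
    + by apply: bounded_mfunX; apply: bounded_mfunD.
    + by apply: bounded_mfunD => //; apply: bounded_mfunD => //; exact: bZ.
    + move=> s s01; have gs := gh s s01; have g01 := gs01 s.
      have -> : `|piece eta None s| + `|piece eta (Some true) s| =
          g s + eta * haar s.
        rewrite /piece; case: (leP s 2^-1) => s2 /=.
          rewrite subrr mulr0 normr0 addr0 mulr1 ger0_norm//.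
          by case: (haar_cases s) => -[hs ->]; lra.
        have -> : haar s = 0 by case: (haar_cases s) => -[hs ->]//; lra.
        by rewrite !mulr0 !addr0 subr0 mulr1 normr0 add0r ger0_norm; lra.
      have h1 : -1 <= haar s <= 1 by case: (haar_cases s) => -[hs ->]; lra.
      have h2 : haar s ^+ 2 <= 1 by nra.
      have h0 : 0 <= g s + eta * haar s <= 2.
        case: (haar_cases s) => -[hs ->]; last lra.
          by have := gs ltac:(lra); lra.
        by have := gs ltac:(lra); lra.
      apply: le_trans (tangent _ _ g01 h0) _.
      rewrite extremalX// -addrA lerD2l; apply: lerD; first by rewrite !mulrA.
      by rewrite exprMn ler_wpM2l// ler_piMr// sqr_ge0.
  rewrite int01D//; last by apply: bounded_mfunD => //; exact: bZ.
  rewrite -/mass int01D//; last exact: bZ.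
  rewrite int01Zl// int01_cst.
  have qe0 : 0 <= q%:R * eta by rewrite mulr_ge0// ltW.
  have := ler_wpM2l qe0 (@int01_haar_tail R).
  have := ler_wpM2r (ltW e0) es; have := ler_wpM2r (ltW e0) q2.
  rewrite expr2 mulrA; lra.
(* Both pieces vanish right of 1/2, and left of it the base is at most [g + 2 * eta]; what the
   tangent bound adds is far below the lost [high]. *)
- apply: (@le_trans _ _ (int01 (fun s =>
    g s ^+ q * e s + (2 * (q%:R * eta) + 4 ^+ q * (2 * eta) ^+ 2)))).
    apply: le_int01.
    + by apply: bounded_mfunX; apply: bounded_mfunD.
    + by apply: bounded_mfunD => //; exact: bounded_mfunM.
    + move=> s s01; have gs := gh s s01; have g01 := gs01 s.
      rewrite /piece; case: (leP s 2^-1) => s2 /=; last first.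
        have -> : haar s = 0 by case: (haar_cases s) => -[hs ->]//; lra.
        rewrite !mulr0 addr0 oppr0 normr0 addr0 expr0n.
        rewrite gtn_eqF ?(ltnW q1)// add0r.
        by rewrite addr_ge0// mulr_ge0// ?sqr_ge0// mulr_ge0// ltW.
      rewrite !mulr1; apply: (@le_trans _ _ ((g s + 2 * eta) ^+ q)).
        apply: lerXn2r; rewrite ?nnegrE; [by rewrite addr_ge0|lra|].
        have h1 : `|eta * haar s| <= eta.
          rewrite normrM gtr0_norm// ler_piMr//; first exact: ltW.
          by rewrite ler_norml; case: (haar_cases s) => -[hs ->]; lra.
        rewrite normrN; apply: le_trans (lerD (ler_normD _ _) (lexx _)) _.
        by rewrite ger0_norm; lra.
      apply: le_trans (tangent _ _ g01 _) _; first lra.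
      rewrite extremalX// -addrA lerD2l lerD2r.
      rewrite [leRHS](_ : _ = q%:R * (2 * eta)); last by ring.
      by rewrite ler_piMr ?tail_le1// mulr_ge0// mulr_ge0// ltW.
  rewrite int01D//; last exact: bounded_mfunM.
  rewrite int01_cst extremal_mass_split -/low; have := high_ge.
  have := eta_le_pow; have := ler_wpM2r (ltW e0) es; have := q_eta.
  have -> : 4 ^+ q * (2 * eta) ^+ 2 = 4 * (4 ^+ q * eta * eta) by ring.
  lra.
Qed.

End Pieces.

(** * The initial error *)

Section InitialError.
Context {R : realType}.

(** Young's inequality, with equality at [x = y]. The induction multiplies by [y] and adds the
    product of [x - y] and [x ^+ n.+1 - y ^+ n.+1], two factors of the same sign. *)
Lemma young_expr (x y : R) n : 0 <= x -> 0 <= y ->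
  n.+1%:R * (x * y ^+ n) <= x ^+ n.+1 + n%:R * y ^+ n.+1.
Proof.
move=> x0 y0; elim: n => [|n IH]; first by rewrite expr0 expr1 mulr1 mul0r mul1r addr0.
have h : 0 <= (x - y) * (x ^+ n.+1 - y ^+ n.+1).
  have [xy|/ltW xy] := leP y x.
    by rewrite mulr_ge0// subr_ge0//; apply: lerXn2r; rewrite ?nnegrE.
  by rewrite mulr_le0// subr_le0//; apply: lerXn2r; rewrite ?nnegrE.
rewrite -subr_ge0; have := ler_wpM2l y0 IH; rewrite -subr_ge0 => h'.
have -> : x ^+ n.+2 + n.+1%:R * y ^+ n.+2 - n.+2%:R * (x * y ^+ n.+1) =
    y * (x ^+ n.+1 + n%:R * y ^+ n.+1) - y * (n.+1%:R * (x * y ^+ n)) +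
    (x - y) * (x ^+ n.+1 - y ^+ n.+1).
  by rewrite -[n.+2%:R]natr1 -[n.+1%:R]natr1 !exprS; ring.
exact: addr_ge0.
Qed.

Lemma abse_fine_le (y : \bar R) : ((`|fine y|)%:E <= `|y|)%E.
Proof. by case: y => [r| |] //=; rewrite ?normr0 ?leey. Qed.

(** As [g] is only measurable, absolute values are taken inside both integrals before Tonelli
    exchanges them; the inner integral of the box indicator then factors into tails. *)
Lemma abse_I_d_F_of_le d (g : d.-tuple R -> R) : measurable_fun setT g ->
  ((`|I_d d (F_of d g)|)%:E <=
   cube_int d (fun t => (`|g t| * \prod_j tail (tnth t j))%:E))%E.
Proof.
move=> mg.
pose b (z : d.-tuple R * d.-tuple R) : R := (box_below d z.1 z.2)%:R.
have mb : measurable_fun setT b.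
  rewrite /b; under eq_fun do rewrite box_belowE.
  apply: measurable_prod => j _; apply: measurable_ler_indicator.
    by apply: (measurableT_comp (@measurable_tnth _ _ _ j)).
  by apply: (measurableT_comp (@measurable_tnth _ _ _ j)).
have mgb : measurable_fun setT (fun z => (g z.2 * b z)%:E).
  by apply/measurable_EFinP/measurable_funM => //; exact: measurableT_comp.
pose h (z : d.-tuple R * d.-tuple R) : \bar R := (`|(g z.2 * b z)%:E|)%E.
have mh : measurable_fun setT h by exact: measurableT_comp.
have h0 z : (0 <= h z)%E by exact: abse_ge0.
have mF : measurable_fun setT (EFin \o F_of d g).
  apply/measurable_EFinP; rewrite (_ : F_of d g = fine \o
      (fun x => cube_int d (fun t => (g t * b (x, t))%:E)))//.
  apply: measurableT_comp => //.
  exact: (measurable_cube_int _ _ _ (fun z => (g z.2 * b z)%:E)).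
apply: le_trans (abse_fine_le _) _.
apply: le_trans (le_abse_cube_int _ _ mF) _.
apply: (@le_trans _ _ (cube_int d (fun x => cube_int d (fun t => h (x, t))))).
  apply: le_cube_int => //.
  - exact: measurableT_comp.
  - exact: measurable_cube_int.
  - move=> x; apply: le_trans (abse_fine_le _) _.
    apply: le_abse_cube_int.
    exact: (measurable_slice _ _ _ _ (fun z => (g z.2 * b z)%:E)).
rewrite cube_int_swap// le_eqVlt; apply/orP; left; apply/eqP.
congr cube_int; apply/funext => t.
rewrite -(cube_int_prod _ _ (fun j x => (tnth t j <= x)%R%:R)); last first.
  by move=> j; exact: bounded_mfun_ler.
congr cube_int; apply/funext => x.
rewrite /h /= normrM; congr (_ * _)%:E.
by rewrite /b box_belowE ger0_norm// prodr_ge0.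
Qed.

Lemma cube_int_extremal q d :
  cube_int d (fun t => ((\prod_j extremal q (tnth t j)) ^+ q)%:E) =
  ((@extremal_mass R q) ^+ d)%:E.
Proof.
transitivity (cube_int d (fun t =>
    (1 * \prod_j (extremal q (tnth t j) ^+ q : R))%:E)).
  by congr cube_int; apply/funext => t; rewrite mul1r prodrXl.
rewrite (cube_int_prod _ 1 (fun _ s => extremal q s ^+ q)).
  by rewrite mul1r prodr_const card_ord.
by move=> _; apply: bounded_mfunX; exact: bounded_mfun_extremal.
Qed.

Lemma Lq_norm_le1 q d (g : d.-tuple R -> R) : (0 < q)%N ->
  ((Lq_norm q d g <= 1) = (cube_int d (fun t => (`|g t| ^+ q)%:E) <= 1))%E.
Proof.
move=> q0; rewrite /Lq_norm.
have c0 : (0 <= cube_int d (fun t => (`|g t| ^+ q)%:E))%E.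
  by apply: cube_int_ge0 => t; rewrite lee_fin exprn_ge0.
have p0 : 0 < (q%:R : R)^-1 by rewrite invr_gt0 ltr0n.
case: (cube_int _ _) c0 => [r| |]//; last first.
  by rewrite poweRyr ?gt_eqF.
rewrite poweR_EFin !lee_fin => r0.
have [nr n1] : r \in Num.nneg /\ (1 : R) \in Num.nneg by rewrite !nnegrE.
apply/idP/idP => [|r1].
  apply: contraTT; rewrite -!ltNge => r1.
  by have := gt0_ltr_powR p0 n1 nr r1; rewrite powR1.
by have := ge0_ler_powR (ltW p0) nr n1 r1; rewrite powR1.
Qed.

(** Hoelder's inequality, obtained by integrating Young's inequality for [|g t|] against the
    normalised tensor power of [extremal]. Here [gam] is the univariate L_q norm of [extremal q]. *)
Lemma init_error_le q d (gam : R) : (1 < q)%N -> 0 < gam ->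
  gam ^+ q = extremal_mass q ->
  (init_error q d <= ((gam ^+ d) ^+ q.-1)%:E :> \bar R)%E.
Proof.
move=> q1 gam0 gamq; apply: ge_ereal_sup => _ [g [mg ng] <-].
rewrite Lq_norm_le1 ?(ltnW q1)// in ng.
apply: le_trans (abse_I_d_F_of_le _ _ mg) _.
pose G (t : d.-tuple R) := \prod_j extremal q (tnth t j).
have G0 t : 0 <= G t by apply: prodr_ge0 => j _; exact: extremal_ge0.
have mG : measurable_fun setT G.
  apply: measurable_prod => j _; have [mE _] := @bounded_mfun_extremal R q.
  exact: (measurableT_comp mE (@measurable_tnth _ _ _ j)).
(* With this factor [m * G] has L_q norm 1, so the integrated right-hand side of Young's inequality
   is at most 1 + (q - 1) = q. *)
pose m := (gam ^+ d)^-1.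
have gd0 : 0 < gam ^+ d by rewrite exprn_gt0.
have m0 : 0 < m by rewrite invr_gt0.
set J := cube_int _ _.
have qE : q = q.-1.+1 by rewrite (ltn_predK q1).
have q0 : 0 < (q%:R : R) by rewrite ltr0n ltnW.
have mga : measurable_fun setT (fun t => `|g t|) by exact: measurableT_comp.
have JE : J = cube_int d (fun t => (`|g t| * G t ^+ q.-1)%:E).
  congr cube_int; apply/funext => t; congr (_ * _)%:E.
  by rewrite /G -prodrXl; apply: eq_bigr => j _; rewrite extremalX.
pose k : R := q.-1%:R * m ^+ q.
have k0 : 0 <= k by rewrite mulr_ge0// exprn_ge0// ltW.
have mgq : measurable_fun setT (fun t => (`|g t| ^+ q)%:E).
  by apply/measurable_EFinP; exact: measurable_funX.
have mGq : measurable_fun setT (fun t => (G t ^+ q)%:E).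
  by apply/measurable_EFinP; exact: measurable_funX.
have mkGq : measurable_fun setT (fun t => k%:E * (G t ^+ q)%:E)%E.
  exact: measurable_funeM.
have young : ((q%:R * m ^+ q.-1)%:E * J <= (q%:R)%:E)%E.
  rewrite JE -cube_intZl; first last.
  - by move=> t; rewrite lee_fin mulr_ge0// exprn_ge0.
  - apply/measurable_EFinP; apply: measurable_funM => //.
    exact: measurable_funX.
  - by rewrite mulr_ge0// exprn_ge0// ltW.
  apply: (@le_trans _ _ (cube_int d (fun t => (`|g t| ^+ q)%:E +
      k%:E * (G t ^+ q)%:E)))%E.
    apply: le_cube_int.
    + apply: measurable_funeM; apply/measurable_EFinP.
      by apply: measurable_funM => //; exact: measurable_funX.
    + exact: emeasurable_funD.
    + move=> t; rewrite -EFinM lee_fin mulr_ge0//.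
        by rewrite mulr_ge0// exprn_ge0// ltW.
      by rewrite mulr_ge0// exprn_ge0.
    + move=> t; rewrite -!EFinM lee_fin.
      have := young_expr `|g t| (m * G t) q.-1 (normr_ge0 _) (mulr_ge0 (ltW m0) (G0 t)).
      by rewrite -qE !exprMn /k -2!mulrA [m ^+ _ * (_ * _)]mulrCA.
  rewrite cube_intD//; last first.
    by move=> t; rewrite -EFinM lee_fin mulr_ge0// exprn_ge0.
  rewrite cube_intZl//; last by move=> t; rewrite lee_fin exprn_ge0.
  rewrite cube_int_extremal -gamq -EFinM /k -mulrA -exprM mulnC exprM -exprMn.
  rewrite mulVf ?gt_eqF// expr1n mulr1.
  apply: le_trans (leeD2r _ ng) _; rewrite -EFinD lee_fin.
  by rewrite [in leRHS]qE -natr1 addrC.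
have J0 : (0 <= J)%E.
  by apply: cube_int_ge0 => t; rewrite lee_fin mulr_ge0// prodr_ge0// => j _;
    exact: tail_ge0.
case: J J0 young {JE} => [r| |]// _.
  rewrite !lee_fin -[leRHS]mulr1 -mulrA ler_pM2l// => h.
  by rewrite -[leRHS]mul1r -ler_pdivrMr ?exprn_gt0// mulrC -exprVn.
by rewrite gt0_muley// lte_fin mulr_gt0// exprn_gt0.
Qed.

End InitialError.

(** * The fooling function *)

Section UnionBound.
Context {R : realType}.

Lemma sum_option_bool (F : option bool -> R) :
  \sum_o F o = F None + (F (Some true) + F (Some false)).
Proof.
rewrite (bigD1 None)//= (bigD1 (Some true))//= (bigD1 (Some false))//=.
by rewrite big1 ?addr0// => -[[]|].
Qed.

Lemma sum_option_bool_neq (F : option bool -> R) b :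
  \sum_(o | o != Some b) F o = F None + F (Some (~~ b)).
Proof.
rewrite big_mkcond sum_option_bool/=.
by case: b => /=; rewrite ?add0r ?addr0.
Qed.

(* [i] picks a piece in each coordinate and [Some (b k j)] is the piece to which
   coordinate [j] of node [k] is blind: the product of the pieces is seen by no
   node. *)
Definition missed d N (b : 'I_N -> 'I_d -> bool) (i : {ffun 'I_d -> option bool}) :=
  [forall k, i \notin family (fun j => [pred o | o != Some (b k j)])].

(** Expanding the product of sums, the difference consists of the choices that avoid the blind
    pieces of some node [k]. For fixed [k] these choices form a product set, so the sum of their
    absolute values factors again. *)
Lemma missed_union_bound d N (b : 'I_N -> 'I_d -> bool)
    (F : 'I_d -> option bool -> R) :
  `| \sum_(i | missed d N b i) \prod_j F j (i j) - \prod_j \sum_o F j o | <=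
  \sum_k \prod_j (`|F j None| + `|F j (Some (~~ b k j))|).
Proof.
rewrite bigA_distr_bigA/= [X in _ - X](bigID (missed d N b))/= opprD addrA subrr.
rewrite sub0r normrN; apply: le_trans (ler_norm_sum _ _ _) _.
have E k : \prod_j (`|F j None| + `|F j (Some (~~ b k j))|) =
    \sum_(i in family (fun j => [pred o | o != Some (b k j)])) `|\prod_j F j (i j)|.
  under [RHS]eq_bigr do rewrite normr_prod.
  rewrite -(bigA_distr_big_dep _ (fun j o => `|F j o|)).
  by apply: eq_bigr => j _; rewrite -(sum_option_bool_neq (fun o => `|F j o|)).
under [leRHS]eq_bigr do rewrite E big_mkcond/=.
rewrite exchange_big/= big_mkcond/=; apply: ler_sum => i _.
have s0 k : 0 <= (if i \in family (fun j => [pred o | o != Some (b k j)])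
    then `|\prod_j F j (i j)| else 0) by case: ifP.
case: ifPn => [|_]; last exact: sumr_ge0.
rewrite negb_forall => /existsP[k]; rewrite negbK => ik.
by rewrite (bigD1 k)//= ik lerDl sumr_ge0.
Qed.

(** Either [y <= l * x] or [x <= l^-1 * y], and then one of the two terms alone suffices. The factor
    of the main term [x] tends to 1 with [l]. *)
Lemma exprD_le_split (x y l : R) n : 0 <= x -> 0 <= y -> 0 < l ->
  (x + y) ^+ n <= (1 + l) ^+ n * x ^+ n + (1 + l^-1) ^+ n * y ^+ n.
Proof.
move=> x0 y0 l0; rewrite -!exprMn.
have l1 : 0 <= l^-1 by rewrite invr_ge0 ltW.
have [xy|/ltW xy] := leP y (l * x).
  apply: ler_wpDr; first by rewrite exprn_ge0// mulr_ge0// addr_ge0.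
  by apply: lerXn2r; rewrite ?nnegrE; [lra|rewrite mulr_ge0// addr_ge0// ltW|lra].
apply: ler_wpDl; first by rewrite exprn_ge0// mulr_ge0// addr_ge0// ltW.
have : x <= l^-1 * y by rewrite ler_pdivlMl.
by move=> h; apply: lerXn2r; rewrite ?nnegrE; [lra|rewrite mulr_ge0// addr_ge0|lra].
Qed.

(** Every summand is replaced by the largest one. The power of [N] obtained only influences the
    exponent in the choice of [C]. *)
Lemma exprn_sum_le N (y : 'I_N -> R) n : (forall k, 0 <= y k) ->
  (\sum_k y k) ^+ n.+1 <= N%:R ^+ n.+1 * \sum_k y k ^+ n.+1.
Proof.
case: N y => [|N] y y0; first by rewrite !big_ord0 expr0n mulr0.
have [m _ ym] := @arg_maxP _ _ _ ord0 predT y isT.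
apply: (@le_trans _ _ ((N.+1%:R * y m) ^+ n.+1)).
  apply: lerXn2r; rewrite ?nnegrE ?sumr_ge0 ?mulr_ge0//.
  rewrite -[N.+1 in leRHS]card_ord mulr_natl -sumr_const.
  by apply: ler_sum => k _; exact: ym.
rewrite exprMn ler_wpM2l ?exprn_ge0//.
by rewrite (bigD1 m)//= lerDl sumr_ge0// => k _; rewrite exprn_ge0.
Qed.

End UnionBound.

(** * Integral and norm of the fooling function *)

Section Fooling.
Context {R : realType}.
Variables q d N : nat.
Hypothesis q1 : (1 < q)%N.
Variable X : 'I_N -> d.-tuple R.
Local Notation mass := (@extremal_mass R q).
Local Notation phi := (@piece R q (eta q)).

(** Chosen so that [kappa * mass] is the common upper bound [mass - eta q / 128] of
    [piece_moment_le] and [piece_power_le]. *)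
Definition kappa : R := 1 - eta q / 128 / mass.

Let b (k : 'I_N) (j : 'I_d) : bool := tnth (X k) j < 2^-1.

Definition fooling (c : R) (t : d.-tuple R) : R :=
  \sum_(i | missed d N b i) c * \prod_j phi (i j) (tnth t j).

Let h (e : bool) (s : R) : R := `|phi None s| + `|phi (Some e) s|.

Let bphi i : bounded_mfun (phi i).
Proof. exact: bounded_mfun_piece. Qed.

Let bh e : bounded_mfun (h e).
Proof. by apply: bounded_mfunD; exact: bounded_mfun_norm. Qed.

Let mass_neq0 : mass != 0.
Proof. by rewrite gt_eqF// extremal_mass_gt0. Qed.

Let kappa_mass : kappa * mass = mass - eta q / 128.
Proof. by rewrite /kappa; field. Qed.

(** Each product in the sum uses, in some coordinate, the piece to which node [k] is blind, and that
    factor of its primitive vanishes. *)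
Lemma F_of_fooling c k : F_of d (fooling c) (X k) = 0.
Proof.
rewrite /fooling (F_of_sum_prod _ _ _ (fun=> c)
  (fun (i : {ffun _ -> _}) j => phi (i j)))//.
rewrite big1// => i /forallP/(_ k) /familyP ik.
have [j ij] : exists j, i j = Some (b k j).
  apply: contrapT => /forallNP nij; apply: ik => j.
  by rewrite inE; apply/eqP; exact: nij.
by rewrite (bigD1 j)//= ij primitive_piece mul0r mulr0.
Qed.

Lemma measurable_fooling c : measurable_fun setT (fooling c).
Proof.
apply: (measurable_sum_prod _ _ _ (fun=> c)
  (fun (i : {ffun _ -> _}) j => phi (i j))) => i j.
by have [] := bphi (i j).
Qed.

Lemma fooling_le c t : 0 <= c -> `|fooling c t| <=
  c * (\prod_j extremal q (tnth t j) + \sum_k \prod_j h (~~ b k j) (tnth t j)).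
Proof.
move=> c0; rewrite /fooling -mulr_sumr normrM ger0_norm// ler_wpM2l//.
have := missed_union_bound d N b (fun j o => phi o (tnth t j)).
under [X in _ - X]eq_bigr do rewrite sum_option_bool sum_piece.
set S := \sum_(i | _) _; set G := \prod_j _ => hS.
have G0 : 0 <= G by apply: prodr_ge0 => j _; exact: extremal_ge0.
rewrite -[S](subrK G) addrC -[X in _ <= X + _](ger0_norm G0).
by apply: le_trans (ler_normD _ _) _; rewrite lerD2l.
Qed.

(** The union bound applied to the moments of the pieces: all choices together give [mass ^+ d], and
    each node removes at most [(kappa * mass) ^+ d]. *)
Lemma I_d_fooling_ge c : 0 <= c ->
  c * (mass ^+ d - N%:R * (kappa * mass) ^+ d) <= I_d d (F_of d (fooling c)).
Proof.
move=> c0; rewrite /fooling (I_d_F_of_sum_prod _ _ _ (fun=> c)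
  (fun (i : {ffun _ -> _}) j => phi (i j)))//.
rewrite -mulr_sumr ler_wpM2l//.
pose M o := int01 (fun s => phi o s * tail s).
have M0 o : 0 <= M o by apply: piece_tail_ge0 => //; exact: eta_itv.
have := missed_union_bound d N b (fun _ o => M o).
have -> : \prod_(j < d) \sum_o M o = mass ^+ d.
  rewrite -[in RHS](card_ord d) -prodr_const; apply: eq_bigr => j _.
  have bpt o : bounded_mfun (fun s => phi o s * tail s).
    by apply: bounded_mfunM => //; exact: bounded_mfun_tail.
  rewrite sum_option_bool /M -int01D// -int01D//; last exact: bounded_mfunD.
  congr int01; apply/funext => s.
  by rewrite -!mulrDl sum_piece extremalS.
rewrite ler_norml => /andP[+ _]; rewrite lerBrDr; apply: le_trans.
rewrite addrC lerD2r lerN2.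
rewrite -[N in leRHS]card_ord mulr_natl -sumr_const; apply: ler_sum => k _.
rewrite -[in leRHS](card_ord d) -prodr_const.
apply: ler_prod => j _; rewrite addr_ge0//= !ger0_norm//.
by rewrite kappa_mass; exact: piece_moment_le.
Qed.

Lemma cube_int_fooling_le c l : 0 <= c -> 0 < l ->
  (cube_int d (fun t => (`|fooling c t| ^+ q)%:E) <=
   (c ^+ q * ((1 + l) ^+ q * mass ^+ d + (1 + l^-1) ^+ q *
      (N%:R ^+ q.+1 * (kappa * mass) ^+ d)))%:E)%E.
Proof.
move=> c0 l0.
have l1 : 0 <= l^-1 by rewrite invr_ge0 ltW.
pose G (t : d.-tuple R) := \prod_j extremal q (tnth t j).
pose H (t : d.-tuple R) := \sum_k 1 * \prod_j (h (~~ b k j) (tnth t j) ^+ q).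
have G0 t : 0 <= G t by apply: prodr_ge0 => j _; exact: extremal_ge0.
have h0 e s : 0 <= h e s by rewrite addr_ge0.
have H0 t : 0 <= H t.
  by apply: sumr_ge0 => k _; rewrite mul1r prodr_ge0// => j _; rewrite exprn_ge0.
have mG : measurable_fun setT (fun t => (G t ^+ q)%:E).
  apply/measurable_EFinP/measurable_funX.
  apply: measurable_prod => j _; have [mE _] := @bounded_mfun_extremal R q.
  exact: (measurableT_comp mE (@measurable_tnth _ _ _ j)).
have bhq e : bounded_mfun (fun s => h e s ^+ q) by exact: bounded_mfunX.
have mH : measurable_fun setT (fun t => (H t)%:E).
  apply/measurable_EFinP; apply: (measurable_sum_prod _ _ _ _
    (fun k j s => h (~~ b k j) s ^+ q)) => k j.
  by have [] := bhq (~~ b k j).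
pose k1 := c ^+ q * (1 + l) ^+ q.
pose k2 := c ^+ q * ((1 + l^-1) ^+ q * N%:R ^+ q).
have k10 : 0 <= k1 by rewrite mulr_ge0 ?exprn_ge0 ?addr_ge0 ?(ltW l0).
have k20 : 0 <= k2 by rewrite !mulr_ge0 ?exprn_ge0 ?addr_ge0.
apply: (@le_trans _ _ (cube_int d (fun t =>
    k1%:E * (G t ^+ q)%:E + k2%:E * (H t)%:E)))%E.
  apply: le_cube_int.
  - apply/measurable_EFinP/measurable_funX; apply: measurableT_comp => //.
    exact: measurable_fooling.
  - by apply: emeasurable_funD; exact: measurable_funeM.
  - by move=> t; rewrite lee_fin exprn_ge0.
  - move=> t; rewrite -!EFinM -EFinD lee_fin.
    pose S := \sum_k \prod_j h (~~ b k j) (tnth t j).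
    have S0 : 0 <= S by apply: sumr_ge0 => k _; exact: prodr_ge0.
    apply: (@le_trans _ _ ((c * (G t + S)) ^+ q)).
      apply: lerXn2r; rewrite ?nnegrE ?mulr_ge0 ?addr_ge0//.
      exact: fooling_le.
    rewrite exprMn /k1 /k2 -!mulrA -mulrDr ler_wpM2l ?exprn_ge0//.
    apply: le_trans (exprD_le_split _ _ l q (G0 t) S0 l0) _.
    rewrite lerD2l ler_wpM2l ?exprn_ge0 ?addr_ge0//.
    rewrite /S -(ltn_predK q1); apply: le_trans (exprn_sum_le _ _ _ _) _.
      by move=> k; exact: prodr_ge0.
    rewrite ler_wpM2l ?exprn_ge0// le_eqVlt; apply/orP; left; apply/eqP.
    by apply: eq_bigr => k _; rewrite mul1r prodrXl (ltn_predK q1).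
rewrite cube_intD; [|exact: measurable_funeM..| |]; last 2 first.
- by move=> t; rewrite -EFinM lee_fin mulr_ge0// exprn_ge0.
- by move=> t; rewrite -EFinM lee_fin mulr_ge0.
rewrite !cube_intZl//; last by move=> t; rewrite lee_fin exprn_ge0.
rewrite cube_int_extremal.
rewrite (cube_int_sum_prod _ _ _ _ (fun k j s => h (~~ b k j) s ^+ q))//.
rewrite -!EFinM -EFinD lee_fin /k1 /k2 -!mulrA -mulrDr ler_wpM2l ?exprn_ge0//.
rewrite lerD2l ler_wpM2l ?exprn_ge0 ?addr_ge0//.
(* [N ^ q] stems from the power of the sum over the nodes; the additional factor [N] comes from
   adding up [N] equal bounds. *)
rewrite exprSr -mulrA ler_wpM2l ?exprn_ge0//.
rewrite -[N in leRHS]card_ord mulr_natl -sumr_const; apply: ler_sum => k _.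
rewrite mul1r -[in leRHS](card_ord d) -prodr_const.
apply: ler_prod => j _; apply/andP; split.
  by apply: Rintegral_ge0 => s _; rewrite exprn_ge0.
by rewrite kappa_mass; exact: piece_power_le.
Qed.

End Fooling.

(** * From the fooling function to the information complexity *)

Section InformationComplexity.
Context {R : realType}.
Variable q : nat.
Hypothesis q1 : (1 < q)%N.
Local Notation mass := (@extremal_mass R q).
Local Notation kappa := (@kappa R q).

Lemma kappa_itv : 0 < kappa < 1.
Proof.
have m0 := @extremal_mass_gt0 R q q1; have e0 := @eta_gt0 R q q1.
have em : eta q / 128 < mass.
  have := @extremal_mass_gt R q q1; have := @eta_le_pow R q q1; lra.
rewrite /kappa subr_gt0 ltr_pdivrMr// mul1r em/= ltrBlDr ltrDl.
by rewrite divr_gt0// divr_gt0.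
Qed.

Lemma min_error_ge d N (gam l : R) : 0 < gam -> gam ^+ q = mass ->
  0 < l < 1 -> N%:R ^+ q.+1 * kappa ^+ d <= l ^+ q.+2 ->
  N%:R * kappa ^+ d <= l ->
  (((1 - l) ^+ 2 * (gam ^+ d) ^+ q.-1)%:E <= min_error q N d :> \bar R)%E.
Proof.
move=> gam0 gamq /andP[l0 l1] Nq Nl.
apply: le_ereal_inf_tmp => _ [X _ [phi phi0 <-]].
have gd0 : 0 < gam ^+ d by rewrite exprn_gt0.
have gdq : (gam ^+ d) ^+ q = mass ^+ d by rewrite -exprM mulnC exprM gamq.
(* Division by [gam ^+ d] normalises the tensor power of [extremal]; the factor [1 - l] leaves room
   for the error terms in the unit ball condition. *)
pose c := (1 - l) / gam ^+ d.
have c0 : 0 <= c by rewrite divr_ge0 ?(ltW gd0)// subr_ge0 ltW.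
have cq : c ^+ q * mass ^+ d = (1 - l) ^+ q.
  by rewrite -gdq -exprMn /c divfK// gt_eqF.
pose g := fooling q d N X c.
apply: (@le_trans _ _ (`|I_d d (F_of d g) - phi (fun i => F_of d g (X i))|)%:E).
  (* All data of the fooling function are zero, so the algorithm answers [phi] of zero, which is
     0. *)
  have -> : (fun i => F_of d g (X i)) = (fun=> 0).
    by apply/funext => k; rewrite F_of_fooling.
  rewrite phi0 subr0 lee_fin; apply: le_trans (ler_norm _).
  apply: le_trans (I_d_fooling_ge _ _ _ q1 X c c0).
  have -> : mass ^+ d - N%:R * (kappa * mass) ^+ d =
      (1 - N%:R * kappa ^+ d) * mass ^+ d by rewrite exprMn; ring.
  have -> : (gam ^+ d) ^+ q.-1 = (gam ^+ d)^-1 * mass ^+ d.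
    by rewrite -gdq -[in RHS](ltn_predK q1) exprS mulKf// gt_eqF.
  have M0 : 0 <= (gam ^+ d)^-1 * mass ^+ d.
    by rewrite mulr_ge0 ?invr_ge0 ?exprn_ge0 ?(ltW (@extremal_mass_gt0 R q q1))
      ?ltW.
  rewrite /c (_ : _ / _ * _ = (1 - l) * (1 - N%:R * kappa ^+ d) *
    ((gam ^+ d)^-1 * mass ^+ d)); last by ring.
  by rewrite ler_wpM2r// expr2 ler_wpM2l ?lerD2l ?lerN2// subr_ge0 ltW.
apply: ereal_sup_ubound; exists g => //; split; first exact: measurable_fooling.
rewrite Lq_norm_le1 ?(ltnW q1)//.
apply: le_trans (cube_int_fooling_le _ _ _ q1 X c l c0 l0) _; rewrite lee_fin.
have -> : c ^+ q * ((1 + l) ^+ q * mass ^+ d +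
      (1 + l^-1) ^+ q * (N%:R ^+ q.+1 * (kappa * mass) ^+ d)) =
    c ^+ q * mass ^+ d * ((1 + l) ^+ q +
      (1 + l^-1) ^+ q * (N%:R ^+ q.+1 * kappa ^+ d)).
  by rewrite [(kappa * mass) ^+ d]exprMn; ring.
(* The two terms are at most [1 - l ^+ 2] and [l ^+ 2]: the second base is [l^-1 - l], at most
   [l^-1], and the assumed bound [l ^+ q.+2] compensates its q-th power. *)
rewrite cq mulrDr mulrA -!exprMn.
have l2 : 0 <= 1 - l ^+ 2 <= 1.
  by rewrite subr_ge0 exprn_ile1 ?(ltW l0) ?(ltW l1)//= lerBlDr lerDl exprn_ge0// ltW.
have a1 : ((1 - l) * (1 + l)) ^+ q <= 1 - l ^+ 2.
  have -> : (1 - l) * (1 + l) = 1 - l ^+ 2 by ring.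
  have /andP[l20 l21] := l2.
  by rewrite -(ltn_predK q1) exprS ler_piMr// exprn_ile1.
have li : 0 < l^-1 by rewrite invr_gt0.
have a2 : ((1 - l) * (1 + l^-1)) ^+ q * (N%:R ^+ q.+1 * kappa ^+ d) <=
    (l^-1) ^+ q * l ^+ q.+2.
  apply: ler_pM => //.
  - by rewrite exprn_ge0// mulr_ge0 ?subr_ge0 ?addr_ge0// ltW.
  - by rewrite mulr_ge0// exprn_ge0// ltW; have /andP[] := kappa_itv.
  - apply: lerXn2r; rewrite ?nnegrE ?(ltW li)//.
      by rewrite mulr_ge0 ?subr_ge0 ?addr_ge0// ltW.
    have -> : (1 - l) * (1 + l^-1) = l^-1 - l by field; rewrite gt_eqF.
    by rewrite lerBlDr lerDl ltW.
have a3 : (l^-1) ^+ q * l ^+ q.+2 = l ^+ 2.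
  by rewrite -[q.+2]addn2 exprD mulrA -exprMn mulVf ?gt_eqF// expr1n mul1r.
by lra.
Qed.

Lemma N_int_ge d N (C gam eps l : R) : 0 < gam -> gam ^+ q = mass ->
  1 < C -> C ^+ q.+2 * kappa = 1 -> 0 < l < 1 -> 0 < eps -> eps < (1 - l) ^+ 2 ->
  (C^-1) ^+ d <= l ^+ q.+2 ->
  (min_error q N d <= eps%:E * init_error q d)%E -> C ^+ d <= N%:R.
Proof.
move=> gam0 gamq C1 Ck /andP[l0 l1] eps0 el Cl hN.
rewrite leNgt; apply/negP => NC.
have C0 : 0 < C by lra.
have /andP[k0 k1] := kappa_itv.
have kd0 : 0 <= kappa ^+ d by rewrite exprn_ge0// ltW.
(* Of the q + 2 factors of [C] balanced by [kappa], q + 1 pay for the powers of [N < C ^+ d]; the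
   remaining one yields decay. *)
have pow : N%:R ^+ q.+1 * kappa ^+ d <= (C^-1) ^+ d.
  have -> : (C^-1) ^+ d = (C ^+ d) ^+ q.+1 * kappa ^+ d.
    rewrite -exprM mulnC exprM -exprMn; congr (_ ^+ d).
    by rewrite -[C^-1]mulr1 -Ck exprS; field; rewrite gt_eqF.
  rewrite ler_wpM2r//; apply: lerXn2r; rewrite ?nnegrE//; last exact: ltW.
  by rewrite exprn_ge0// ltW.
have Nq := le_trans pow Cl.
have Nl : N%:R * kappa ^+ d <= l.
  apply: (@le_trans _ _ (N%:R ^+ q.+1 * kappa ^+ d)).
    rewrite ler_wpM2r//; case: (N) => [|n]; first by rewrite exprn_ge0.
    by rewrite exprS ler_peMr// exprn_ege1// ler1n.
  apply: le_trans Nq _; rewrite exprS ler_piMr ?(ltW l0)//.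
  by rewrite exprn_ile1 ?(ltW l0) ?(ltW l1).
have l01 : 0 < l < 1 by rewrite l0 l1.
have g0 : 0 < (gam ^+ d) ^+ q.-1 by rewrite !exprn_gt0.
have eps0' : (0 <= eps%:E)%E by rewrite lee_fin ltW.
(* The lower bound on the minimal error and the upper bound on the initial error share the factor
   [(gam ^+ d) ^+ q.-1]; cancelling it contradicts [eps < (1 - l) ^+ 2]. *)
have := le_trans (min_error_ge d N gam l gam0 gamq l01 Nq Nl)
  (le_trans hN (lee_wpmul2l eps0' (init_error_le q d gam q1 gam0 gamq))).
by rewrite -EFinM lee_fin ler_pM2r// leNgt el.
Qed.

End InformationComplexity.

(** * Choice of the constants and exponential growth *)

Theorem theorem2 (R : realType) (q : nat) :
  (0 < q)%N -> ~~ odd q ->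
  exists C : R, 1 < C /\
    forall eps : R, 0 < eps < 1 ->
      exists r : nat -> R, r @ \oo --> 0 /\
        forall d : nat, (0 < d)%N ->
          ((C ^+ d * (1 + r d))%:E <= N_int q eps d)%E.
Proof.
move=> q0 qe; have q1 : (1 < q)%N by case: q q0 qe => [|[]].
have /andP[k0 k1] := @kappa_itv R q q1.
have m0 := @extremal_mass_gt0 R q q1.
pose root n (x : R) : R := x `^ n%:R^-1.
have rootX n x : (0 < n)%N -> 0 <= x -> root n x ^+ n = x.
  move=> n0 x0; rewrite -powR_mulrn ?powR_ge0// -powRrM mulVf ?powRr1//.
  by rewrite pnatr_eq0 -lt0n.
pose gam := root q (extremal_mass q); pose C := root q.+2 (kappa q)^-1.
have gam0 : 0 < gam by rewrite powR_gt0.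
have gamq : gam ^+ q = extremal_mass q by rewrite rootX// ltW.
have CE : C ^+ q.+2 = (kappa q)^-1 by rewrite rootX// invr_ge0 ltW.
have C1 : 1 < C.
  rewrite ltNge; apply/negP => C1.
  have : C ^+ q.+2 <= 1 by rewrite exprn_ile1// powR_ge0.
  by rewrite CE invf_le1// leNgt k1.
exists C; split=> // eps /andP[eps0 eps1].
(* Then [(1 - l) ^+ 2] is ((1 + eps) / 2)^2, which exceeds [eps] by ((1 - eps) / 2)^2. *)
pose l : R := (1 - eps) / 2.
have l01 : 0 < l < 1 by rewrite /l; lra.
have el : eps < (1 - l) ^+ 2 by rewrite /l; nra.
(* The value -1 makes the claimed bound 0 for the finitely many [d] that are too small; afterwards
   [r] is 0, because the powers of [C^-1] tend to 0. *)
pose r d : R := if (C^-1) ^+ d <= l ^+ q.+2 then 0 else -1.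
exists r; split.
  apply: cvg_near_cst; have lq0 : 0 < l ^+ q.+2 by rewrite exprn_gt0; lra.
  have : (fun d => (C^-1) ^+ d) @ \oo --> (0 : R).
    apply: cvg_expr; rewrite ger0_norm ?invr_ge0 ?invf_lt1//; lra.
  move=> /cvgr0_norm_le /(_ _ lq0); apply: filterS => d; rewrite /r => h.
  by rewrite (le_trans (ler_norm _) h).
move=> d _; apply: le_ereal_inf_tmp => _ [N hN <-].
rewrite /r; case: ifP => hd; last by rewrite addrN mulr0 lee_fin.
rewrite addr0 mulr1 lee_fin.
apply: (N_int_ge q q1 d N C gam eps l) => //.
by rewrite CE mulVf// gt_eqF.
Qed.
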